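(* Let $\psi_L$ be the $\mathcal U_q(\mathrm{SU}(2))$-invariant vector, i.e. the power series in $\bar z,z$ with constant term $1$ satisfying $A^*.\psi_L.A^{-1}=\psi_L$ and $C^*.\psi_L=\psi_L.B$, and let $\psi_R(\bar z,z)=\xi_1(\bar z)\xi_2(z)$ be the vector satisfying $B^*.\psi_R.B=-\mu^2q^{1-\delta}\psi_R.A^{2(\delta-1)}$, where $$\xi_1(\bar z)={}_1\Phi_1\bigl(0;-q;q,-i\mu(1-q^2)q^{1-i\nu}\bar z\bigr),$$ $$\xi_2(z)=\begin{cases}{}_0\Phi_2\bigl(-;0,-q;q,-i\mu(1-q^2)q^{3-i\nu}z\bigr)&\text{for }\delta=0,\\ {}_1\Phi_1\bigl(0;-q;q,-i\mu(1-q^2)q\,z\bigr)&\text{for }\delta=1,\\ {}_3\Phi_1\bigl(0,0,0;-q;q,-i\mu(1-q^2)q^{i\nu-1}z\bigr)&\text{for }\delta=2.\end{cases}$$ Then the matrix element $F_\nu^{(\delta)}(H)=\langle\psi_L|\psi_R.g(A|H)\rangle$ has the form of the double integral $$F_\nu^{(\delta)}(H)=q^{i\nu-1}H^{i\nu-1}\iint\frac{(-q^{2i\nu+4}\bar zz,q^2)_\infty}{(-q^2\bar zz,q^2)_\infty}\,\xi_1(q^{i\nu+1}\bar z)\,\xi_2(q^{i\nu-1}H^{-2}z)\,dz\,d\bar z.$$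
   Context: Here $0<q<1$, $\delta\in\{0,1,2\}$, $\nu\in\mathbb R$, $\mu$ is real, $H>0$. Notation: $(a,q)_n=\prod_{j=0}^{n-1}(1-aq^j)$, $(a,q)_\infty=\prod_{j\ge0}(1-aq^j)$. The basic hypergeometric series is $${}_r\Phi_s(a_1,\dots,a_r;b_1,\dots,b_s;q,x)=\sum_{n\ge0}\frac{(a_1,q)_n\cdots(a_r,q)_n}{(q,q)_n(b_1,q)_n\cdots(b_s,q)_n}\Bigl[(-1)^nq^{n(n-1)/2}\Bigr]^{1+s-r}x^n .$$ Power series are understood formally where they do not converge. $V_\nu$ is the space of the class-one principal series: functions $f(\bar z,z)$ with asymptotics $z^{i\nu-1}\bar z^{i\nu-1}$ as $z\to\infty$; the arguments $\bar z$ and $z$ are treated as independent variables that may be rescaled separately. The vector $\psi_R$ is a generalized (Whittaker) vector for this space. The following operators act on the $z$-argument (written on the right): $$f.A=q^{\frac{i\nu-1}2}f(\bar z,q^{-1}z),\qquad f.B=q^{\frac{i\nu}2}\frac{f(\bar z,q^{-1}z)-f(\bar z,qz)}{1-q^2}z^{-1},$$ $$f.C=\frac{z}{1-q^2}\Bigl[-q^{\frac{i\nu+2}2}f(\bar z,q^{-1}z)+q^{-\frac{3i\nu}2+3}f(\bar z,qz)\Bigr],$$ and $A^*.f,B^*.f,C^*.f$ act by the same formulas on the $\bar z$-argument (written on the left). The Hermitian form is $$\langle f|g\rangle=q^{i\nu-1}\iint\overline{f(\bar z,z)}\,g(q^{i\nu+1}\bar z,q^{i\nu-1}z)\,d\bar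 z\,dz .$$ The group element $g(A|H)=e^{\mathcal K\otimes2\phi}$, with $A=e^{\hbar\mathcal K}$, $H=e^\phi$, $\hbar=\ln q$, acts by $f(\bar z,z)\mapsto H^{i\nu-1}f(\bar z,H^{-2}z)$. *)

(* Defs.v *)
(* MathComp-Analysis; the complex numbers are R[i] for R : realType. *)
From HB Require Import structures.
From mathcomp Require Import all_boot all_order all_algebra complex.
From mathcomp Require Import all_classical all_reals all_analysis.
Set Implicit Arguments.
Unset Strict Implicit.
Unset Printing Implicit Defensive.
Import Order.TTheory GRing.Theory Num.Theory numFieldNormedType.Exports.
Local Open Scope classical_set_scope.
Local Open Scope ring_scope.
Local Open Scope complex_scope.

(* The series of the delta = 2 case diverge, and the series of the invariant
   vector only converges on a bidisc around the origin.  Vectors therefore come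
   in two forms: formal power series in two independent variables zb, z
   ("z bar" and z), and functions R[i] -> R[i] -> R[i] of the arguments zb, z.
   The operators are defined on both. *)

Section QCalculus.
Variable R : realType.
Local Notation C := R[i].

(* a ^ s for a base a > 0 and a complex exponent s *)
Definition cpow (a : R) (s : C) : C :=
  (a `^ complex.Re s)%:C *
  (cos (complex.Im s * ln a) +i* sin (complex.Im s * ln a)).

Definition inu (nu : R) : C := 'i * nu%:C.

Definition qpoch (a p : C) (n : nat) : C := \prod_(j < n) (1 - a * p ^+ j).

Definition qpoch_inf (a p : C) : C :=
  lim ((fun n => qpoch a p n : C^o) @ \oo).

(* The n-th coefficient, in x, of rPhis(as; bs; p, x). *)
Definition basic_hyp (as_ bs : seq C) (p : C) (n : nat) : C :=
  (\prod_(a <- as_) qpoch a p n) / (qpoch p p n * \prod_(b <- bs) qpoch b p n) *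
  ((-1) ^+ n * p ^+ 'C(n, 2)) ^ ((size bs).+1%:Z - (size as_)%:Z).

(* One-variable formal power series, as coefficient sequences. *)
Definition fps := nat -> C.

Definition fps_dil (t : C) (f : fps) : fps := fun n => f n * t ^+ n.

Definition fps_mul (f g : fps) : fps :=
  fun n => \sum_(i < n.+1) f i * g (n - i)%N.

(* The inverse of a series f with f 0 = 1, from 1 / f = sum_k (1 - f)^k; only
   the terms k <= n contribute to the coefficient of index n. *)
Definition fps_inv (f : fps) : fps := fun n =>
  (\sum_(k < n.+1) (1 - \poly_(i < n.+1) f i) ^+ k)`_n.

(* (c x, p)_oo as a formal power series in x. *)
Definition qpoch_inf_fps (c p : C) : fps := fun k =>
  lim ((fun n => (\prod_(j < n) (1 - (c * p ^+ j) *: 'X))`_k : C^o) @ \oo).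

Definition fps_eval (f : fps) (x : C) : C :=
  lim ((fun N => \sum_(n < N) f n * x ^+ n : C^o) @ \oo).

(* Two-variable formal power series: f m n is the coefficient of zb^m z^n. *)
Definition fps2 := nat -> nat -> C.

(* f(s zb, t z) *)
Definition dil2 (s t : C) (f : fps2) : fps2 :=
  fun m n => f m n * s ^+ m * t ^+ n.

Definition mulb (f : fps2) : fps2 :=
  fun m n => if m is m'.+1 then f m' n else 0.
Definition mulz (f : fps2) : fps2 :=
  fun m n => if n is n'.+1 then f m n' else 0.

(* Exact division, for series without terms of degree 0 in the variable. *)
Definition divb (f : fps2) : fps2 := fun m n => f m.+1 n.
Definition divz (f : fps2) : fps2 := fun m n => f m n.+1.

Definition mul2 (f g : fps2) : fps2 := fun m n =>
  \sum_(i < m.+1) \sum_(j < n.+1) f i j * g (m - i)%N (n - j)%N.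

(* a(zb) b(z) *)
Definition tens (a b : fps) : fps2 := fun m n => a m * b n.

(* f(zb z) *)
Definition diag2 (f : fps) : fps2 := fun m n => if m == n then f n else 0.

(* Complex conjugation conjugates the coefficients and exchanges zb and z. *)
Definition conj2 (f : fps2) : fps2 := fun m n => conjc (f n m).

End QCalculus.

Section Vectors.
Variables (R : realType) (q nu : R).
Local Notation C := R[i].
Local Notation Q := (q%:C : C).
Local Notation iv := (inu nu).

(** Operators on formal power series *)

Definition opA (f : fps2 R) : fps2 R :=
  cpow q ((iv - 1) / 2) *: dil2 1 Q^-1 f.

Definition opAinv (f : fps2 R) : fps2 R :=
  (cpow q ((iv - 1) / 2))^-1 *: dil2 1 Q f.

Definition opApow (k : int) (f : fps2 R) : fps2 R :=
  match k with
  | Posz n => iter n opA f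
  | Negz n => iter n.+1 opAinv f
  end.

Definition opB (f : fps2 R) : fps2 R :=
  (cpow q (iv / 2) / (1 - Q ^+ 2)) *: divz (dil2 1 Q^-1 f - dil2 1 Q f).

Definition starA (f : fps2 R) : fps2 R :=
  cpow q ((iv - 1) / 2) *: dil2 Q^-1 1 f.

Definition starB (f : fps2 R) : fps2 R :=
  (cpow q (iv / 2) / (1 - Q ^+ 2)) *: divb (dil2 Q^-1 1 f - dil2 Q 1 f).

Definition starC (f : fps2 R) : fps2 R :=
  (1 - Q ^+ 2)^-1 *:
  mulb (- (cpow q ((iv + 2) / 2) *: dil2 Q^-1 1 f)
        + cpow q (- (3 * iv / 2) + 3) *: dil2 Q 1 f).

Definition su2_invariant (f : fps2 R) : Prop :=
  [/\ f 0%N 0%N = 1, starA (opAinv f) = f & starC f = opB f].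

Definition whittaker (mu : R) (delta : nat) (f : fps2 R) : Prop :=
  starB (opB f) =
  (- (mu%:C ^+ 2 * Q ^ (1 - delta%:Z))) *: opApow (2 * (delta%:Z - 1)) f.

(* f.g(A|H) *)
Definition act_g (H : R) (f : fps2 R) : fps2 R :=
  cpow H (iv - 1) *: dil2 1 (H%:C ^- 2) f.

(* The Hermitian form <f|g>; the double integral of a formal integrand enters
   as a functional int2 on formal power series. *)
Definition herm (int2 : fps2 R -> C) (f g : fps2 R) : C :=
  cpow q (iv - 1) *
  int2 (mul2 (conj2 f) (dil2 (cpow q (iv + 1)) (cpow q (iv - 1)) g)).

(** The factors of the Whittaker vector *)

Definition xi1 (mu : R) : fps R :=
  fps_dil (- 'i * mu%:C * (1 - Q ^+ 2) * cpow q (1 - iv))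
    (basic_hyp [:: 0] [:: - Q] Q).

Definition xi2 (mu : R) (delta : nat) : fps R :=
  match delta with
  | 0%N => fps_dil (- 'i * mu%:C * (1 - Q ^+ 2) * cpow q (3 - iv))
             (basic_hyp [::] [:: 0; - Q] Q)
  | 1%N => fps_dil (- 'i * mu%:C * (1 - Q ^+ 2) * Q)
             (basic_hyp [:: 0] [:: - Q] Q)
  | _ => fps_dil (- 'i * mu%:C * (1 - Q ^+ 2) * cpow q (iv - 1))
           (basic_hyp [:: 0; 0; 0] [:: - Q] Q)
  end.

(** Operators on functions *)

Definition fun_opAinv (f : C -> C -> C) (zb z : C) : C :=
  (cpow q ((iv - 1) / 2))^-1 * f zb (Q * z).

Definition fun_opB (f : C -> C -> C) (zb z : C) : C :=
  cpow q (iv / 2) * ((f zb (Q^-1 * z) - f zb (Q * z)) / (1 - Q ^+ 2)) * z^-1.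

Definition fun_starA (f : C -> C -> C) (zb z : C) : C :=
  cpow q ((iv - 1) / 2) * f (Q^-1 * zb) z.

Definition fun_starC (f : C -> C -> C) (zb z : C) : C :=
  zb / (1 - Q ^+ 2) *
  (- cpow q ((iv + 2) / 2) * f (Q^-1 * zb) z
   + cpow q (- (3 * iv / 2) + 3) * f (Q * zb) z).

(* F is the function given by the invariant power series f: its sum near the
   origin, continued by the invariance equations.  In R[i], 0 < zb * z says
   that zb * z is a positive real; this region contains the points (z^*, z),
   z != 0, it is stable under the operators, and it avoids the poles
   zb z = - q^(-2k), k >= 1, of the continuation. *)
Definition invariant_function (f : fps2 R) (F : C -> C -> C) : Prop :=
  (exists2 r : C, 0 < r & forall zb z : C, `|zb| < r -> `|z| < r ->
     (fun N => \sum_(m < N) \sum_(n < N) f m n * zb ^+ m * z ^+ n : C^o) @ \oo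
       --> (F zb z : C^o)) /\
  (forall zb z : C, 0 < zb * z ->
     fun_starA (fun_opAinv F) zb z = F zb z /\
     fun_starC F zb z = fun_opB F zb z).

Definition fun_act_g (H : R) (f : C -> C -> C) (zb z : C) : C :=
  cpow H (iv - 1) * f zb (H%:C ^- 2 * z).

End Vectors.

(* The only property of the double integral used below.  Stating the results
   for all homogeneous functionals leaves room for integrals other than the
   absolutely convergent one (Jackson integrals, regularizations), which the
   growth of the xi's at infinity calls for. *)
Definition homogeneous (R : realType) (V : lmodType R[i]) (I : V -> R[i]) :=
  forall (c : R[i]) (g : V), I (c *: g) = c * I g.

Section PlaneIntegral.
Variable R : realType.
Local Notation C := R[i].
Local Notation mu := (@lebesgue_measure R \x @lebesgue_measure R)%E.

Definition plane_integrable (g : C -> C) : Prop :=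
  mu.-integrable setT (fun p => (complex.Re (g (p.1 +i* p.2)))%:E) /\
  mu.-integrable setT (fun p => (complex.Im (g (p.1 +i* p.2)))%:E).

(* Lebesgue integral over the complex plane, dzb dz being dx dy for
   z = x + iy. *)
Definition plane_int (g : C -> C) : C :=
  if pselect (plane_integrable g) then
    (\int[mu]_p complex.Re (g (p.1 +i* p.2))) +i*
    (\int[mu]_p complex.Im (g (p.1 +i* p.2)))
  else 0.

Let integrable_lin (u v : R * R -> R) (a b : R) :
  mu.-integrable setT (EFin \o u) -> mu.-integrable setT (EFin \o v) ->
  mu.-integrable setT (EFin \o (fun p => a * u p + b * v p)).
Proof.
move=> iu iv.
have h (w : R * R -> R) k : mu.-integrable setT (EFin \o w) ->
    mu.-integrable setT (fun p => k%:E * (EFin \o w) p)%E.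
  exact: integrableZl.
exact: (integrableD measurableT (h u a iu) (h v b iv)).
Qed.

Let Rintegral_lin (u v : R * R -> R) (a b : R) :
  mu.-integrable setT (EFin \o u) -> mu.-integrable setT (EFin \o v) ->
  \int[mu]_p (a * u p + b * v p) = a * \int[mu]_p u p + b * \int[mu]_p v p.
Proof.
move=> iu iv.
have h (w : R * R -> R) k : mu.-integrable setT (EFin \o w) ->
    mu.-integrable setT (EFin \o (fun p => k * w p)).
  exact: integrableZl.
rewrite RintegralD //; [|exact: h|exact: h].
by rewrite !RintegralZl.
Qed.

Let ReM (x y : C) :
  complex.Re (x * y) =
  complex.Re x * complex.Re y + (- complex.Im x) * complex.Im y.
Proof. by case: x y => [a b] [c d] /=; rewrite mulNr. Qed.

Let ImM (x y : C) :
  complex.Im (x * y) =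
  complex.Im x * complex.Re y + complex.Re x * complex.Im y.
Proof. by case: x y => [a b] [c d] /=; rewrite addrC. Qed.

Let plane_integrableZ (c : C) (g : C -> C) :
  plane_integrable g -> plane_integrable (c *: g).
Proof.
move=> [iRe iIm]; split.
  rewrite (_ : (fun _ => _) = EFin \o (fun p : R * R =>
    complex.Re c * complex.Re (g (p.1 +i* p.2)) +
    (- complex.Im c) * complex.Im (g (p.1 +i* p.2)))).
    exact: integrable_lin.
  by apply/funext => p /=; rewrite -ReM.
rewrite (_ : (fun _ => _) = EFin \o (fun p : R * R =>
  complex.Im c * complex.Re (g (p.1 +i* p.2)) +
  complex.Re c * complex.Im (g (p.1 +i* p.2)))).
  exact: integrable_lin.
by apply/funext => p /=; rewrite -ImM.
Qed.

Lemma plane_int_homogeneous : homogeneous plane_int.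
Proof.
move=> c g; rewrite /plane_int.
have [->|c0] := eqVneq c 0.
  rewrite mul0r; case: pselect => [?|] //=.
  have e0 : \int[mu]_p (0 : R) = 0 by rewrite /Rintegral integral0.
  by rewrite scale0r e0.
case: pselect => [ig|nig]; case: pselect => [ig'|nig'].
- have [iRe iIm] := ig'.
  apply/eqP; rewrite eq_complex ReM ImM -!Rintegral_lin //.
  by apply/andP; split; apply/eqP; apply: eq_Rintegral => p _;
    rewrite -?ReM -?ImM.
- exfalso; apply: nig'; have := plane_integrableZ c^-1 ig.
  by rewrite scalerA mulVf // scale1r.
- by exfalso; apply: nig; exact: plane_integrableZ.
- by rewrite mulr0.
Qed.

End PlaneIntegral.

(* <f|g> for functions, the double integral running over the plane zb = z^*. *)
Definition fun_herm (R : realType) (q nu : R) (int2 : (R[i] -> R[i]) -> R[i])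
    (f g : R[i] -> R[i] -> R[i]) : R[i] :=
  cpow q (inu nu - 1) *
  int2 (fun z => conjc (f (conjc z) z) *
    g (cpow q (inu nu + 1) * conjc z) (cpow q (inu nu - 1) * z)).

(* Main.v *)
(* Write t = zb z.  The first invariance equation kills the coefficients of
   zb^m z^n with m <> n, and the second one is a two-term recursion on the
   diagonal, so psi_L = sum_m (q^(2-2 i nu), q^2)_m / (q^2, q^2)_m (-q^2 t)^m.
   By the q-binomial theorem this is the quotient of (-q^(4-2 i nu) t, q^2)_oo
   by (-q^2 t, q^2)_oo, whose conjugate is the kernel of the integral.

   For the function PsiL, which lives beyond the disc of convergence, the
   invariance equations give instead
     PsiL(zb, z) (1 + q^2 t) = PsiL(q^2 zb, z) (1 + q^(4-2 i nu) t)
   for t > 0.  Iterating moves the arguments to the origin, where PsiL tends to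
   1.  The limit also yields the convergence of the numerator, so that only the
   convergence of the real product (-q^2 t, q^2)_oo has to be proved. *)
Require Import Defs.
From mathcomp Require Import all_boot all_order all_algebra complex.
From mathcomp Require Import all_classical all_reals all_analysis.
From mathcomp Require Import ring.
Import Order.TTheory GRing.Theory Num.Theory numFieldNormedType.Exports.
Local Open Scope ring_scope.
Local Open Scope complex_scope.
Set Implicit Arguments.
Unset Strict Implicit.
Unset Printing Implicit Defensive.

(** * Complex powers of a positive base *)

Section ComplexPowers.
Variable R : realType.
Implicit Types (a : R) (s t : R[i]).

Lemma cpowD a s t : 0 < a -> cpow a (s + t) = cpow a s * cpow a t.
Proof.
move=> a_gt0; rewrite /cpow !raddfD /= !mulrDl.
rewrite powRD; last by rewrite (gt_eqF a_gt0) implybT.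
rewrite cosD sinD rmorphM /= [RHS]mulrACA; congr (_ * _).
apply/eqP; rewrite eq_complex /=.
by apply/andP; split; apply/eqP; ring.
Qed.

Lemma cpow0 a : cpow a 0 = 1.
Proof. by rewrite /cpow /= powRr0 mul0r cos0 sin0 mul1r. Qed.

Lemma cpow_neq0 a s : 0 < a -> cpow a s != 0.
Proof.
move=> a_gt0; apply/negP => /eqP s0; have /eqP := cpow0 a.
by rewrite -(subrr s) cpowD// s0 mul0r eq_sym oner_eq0.
Qed.

Lemma cpow_nat a n : 0 < a -> cpow a n%:R = a%:C ^+ n.
Proof.
move=> a_gt0; elim: n => [|n IHn]; first by rewrite cpow0.
rewrite -natr1 cpowD// IHn exprSr; congr (_ * _).
by rewrite /cpow /= powRr1 ?ltW// mul0r cos0 sin0 mulr1.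
Qed.

Lemma cpowN a s : 0 < a -> cpow a (- s) = (cpow a s)^-1.
Proof.
move=> a_gt0; apply: (mulfI (cpow_neq0 s a_gt0)).
by rewrite -cpowD// subrr cpow0 mulfV// cpow_neq0.
Qed.

Lemma conjc_cpow a s : conjc (cpow a s) = cpow a (conjc s).
Proof.
rewrite /cpow rmorphM /=; case: s => x y; congr (_ * _).
  by rewrite /= oppr0.
by rewrite /= mulNr cosN sinN.
Qed.

End ComplexPowers.

(** * The invariant vector as a formal power series *)

Section InvariantVector.
Variables (R : realType) (q nu : R).
Hypotheses (q_gt0 : 0 < q) (q_lt1 : q < 1).
Local Notation C := R[i].
Local Notation Q := (q%:C : C).
Local Notation iv := (inu nu).

Lemma qC_neq0 : Q != 0.
Proof. by rewrite fmorph_eq0 gt_eqF. Qed.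

Lemma qC_expn_neq1 n : 1 - Q ^+ n.+1 != 0.
Proof.
rewrite subr_eq0 eq_sym -rmorphXn /= fmorph_eq1 lt_eqF//.
by rewrite exprn_ilt1// ltW.
Qed.

Lemma qC_expnV_neq0 n : Q^-1 ^+ n.+1 - Q ^+ n.+1 != 0.
Proof.
have h : Q ^+ n.+1 != 0 by rewrite expf_neq0// qC_neq0.
rewrite -(mulIr_eq0 _ (mulIf h)) mulrBl exprVn mulVf// -exprD addnS.
exact: qC_expn_neq1.
Qed.

Lemma cpow_half2 : cpow q ((iv + 2) / 2) = cpow q (iv / 2) * Q.
Proof.
rewrite mulrDl divff ?pnatr_eq0// cpowD//; congr (_ * _).
by rewrite (cpow_nat 1) ?expr1.
Qed.

(** Both powers of q in [starC] share the factor q^(i nu/2 + 1). What remains is q^(2 - 2 i nu), the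
    only place where nu enters the recursion. *)
Lemma cpow_half3 :
  cpow q (- (3 * iv / 2) + 3) = cpow q (iv / 2) * Q * cpow q (2 - 2 * iv).
Proof.
by rewrite -[Q]expr1 -cpow_nat// -!cpowD//; congr cpow; by field.
Qed.

(** Term ratio of the 1Phi0 series with parameter q^(2 - 2 i nu), base q^2 and argument -q^2 t. *)
Definition inv_ratio (m : nat) : C :=
  - Q ^+ 2 * (1 - cpow q (2 - 2 * iv) * (Q ^+ 2) ^+ m) / (1 - (Q ^+ 2) ^+ m.+1).

Definition inv_coef (n : nat) : C := \prod_(m < n) inv_ratio m.

Lemma opAE (f : fps2 R) m n :
  opA q nu f m n = cpow q ((iv - 1) / 2) * (f m n * Q^-1 ^+ n).
Proof.
transitivity (cpow q ((iv - 1) / 2) * (f m n * 1 ^+ m * Q^-1 ^+ n)) => //.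
by rewrite expr1n mulr1.
Qed.

Lemma opAinvE (f : fps2 R) m n :
  opAinv q nu f m n = (cpow q ((iv - 1) / 2))^-1 * (f m n * Q ^+ n).
Proof.
transitivity ((cpow q ((iv - 1) / 2))^-1 * (f m n * 1 ^+ m * Q ^+ n)) => //.
by rewrite expr1n mulr1.
Qed.

Lemma opBE (f : fps2 R) m n :
  opB q nu f m n = cpow q (iv / 2) / (1 - Q ^+ 2) *
    (f m n.+1 * (Q^-1 ^+ n.+1 - Q ^+ n.+1)).
Proof.
transitivity (cpow q (iv / 2) / (1 - Q ^+ 2) * (f m n.+1 * 1 ^+ m * Q^-1 ^+ n.+1
  - f m n.+1 * 1 ^+ m * Q ^+ n.+1)) => //.
by rewrite expr1n mulr1 -mulrBr.
Qed.

Lemma starAE (f : fps2 R) m n :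
  starA q nu f m n = cpow q ((iv - 1) / 2) * (f m n * Q^-1 ^+ m).
Proof.
transitivity (cpow q ((iv - 1) / 2) * (f m n * Q^-1 ^+ m * 1 ^+ n)) => //.
by rewrite expr1n mulr1.
Qed.

Lemma starBE (f : fps2 R) m n :
  starB q nu f m n = cpow q (iv / 2) / (1 - Q ^+ 2) *
    (f m.+1 n * (Q^-1 ^+ m.+1 - Q ^+ m.+1)).
Proof.
transitivity (cpow q (iv / 2) / (1 - Q ^+ 2) * (f m.+1 n * Q^-1 ^+ m.+1 * 1 ^+ n
  - f m.+1 n * Q ^+ m.+1 * 1 ^+ n)) => //.
by rewrite expr1n !mulr1 -mulrBr.
Qed.

Lemma starC0E (f : fps2 R) n : starC q nu f 0%N n = 0.
Proof. exact: mulr0. Qed.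

Lemma starCE (f : fps2 R) m n :
  starC q nu f m.+1 n = (1 - Q ^+ 2)^-1 * (f m n *
    (cpow q (- (3 * iv / 2) + 3) * Q ^+ m - cpow q ((iv + 2) / 2) * Q^-1 ^+ m)).
Proof.
transitivity ((1 - Q ^+ 2)^-1 *
  (- (cpow q ((iv + 2) / 2) * (f m n * Q^-1 ^+ m * 1 ^+ n))
   + cpow q (- (3 * iv / 2) + 3) * (f m n * Q ^+ m * 1 ^+ n))) => //.
by rewrite expr1n; ring.
Qed.

(** The prefactors cancel and the coefficient of zb^m z^n is multiplied by q^(n-m), which equals 1
    only for m = n since 0 < q < 1. *)
Lemma starA_opAinv_diag (f : fps2 R) :
  starA q nu (opAinv q nu f) = f <-> forall m n, m != n -> f m n = 0.
Proof.
have cE m n : starA q nu (opAinv q nu f) m n = f m n * Q^-1 ^+ m * Q ^+ n.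
  rewrite starAE opAinvE; have := cpow_neq0 ((iv - 1) / 2) q_gt0.
  by move: (cpow _ _) => c c0; rewrite -!mulrA mulVKf//; ring.
split=> [fE m n mn|f0].
  have /eqP := congr1 (fun g => g m n) fE; rewrite /= cE.
  rewrite -subr_eq0 -mulrA -{2}[f m n]mulr1 -mulrBr mulf_eq0 => /orP[/eqP//|].
  rewrite -(mulIr_eq0 _ (mulIf (expf_neq0 m qC_neq0))) mulrBl mul1r mulrAC.
  rewrite exprVn mulVf ?expf_neq0 ?qC_neq0// mul1r -!rmorphXn -rmorphB fmorph_eq0.
  rewrite subr_eq0 (inj_eq (ieexprIn q_gt0 (negbT (lt_eqF q_lt1)))).
  by rewrite eq_sym (negPf mn).
apply/funext => m; apply/funext => n; rewrite cE; have [->|mn] := eqVneq m n.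
  by rewrite -mulrA -exprMn mulVf ?qC_neq0// expr1n mulr1.
by rewrite f0// !mul0r.
Qed.

(** On a diagonal series both sides live on the monomials zb^(m+1) z^m. There their difference is
    the defect of the recursion times a nonzero factor ([key], [c_neq0]). *)
Lemma starC_opB_diag (f : fps2 R) : (forall m n, m != n -> f m n = 0) ->
  starC q nu f = opB q nu f <-> forall m, f m.+1 m.+1 = inv_ratio m * f m m.
Proof.
move=> f0.
have h0 := cpow_neq0 (iv / 2) q_gt0.
have key m : starC q nu f m.+1 m - opB q nu f m.+1 m =
   cpow q (iv / 2) / (1 - Q ^+ 2) * (Q^-1 ^+ m.+1 - Q ^+ m.+1) *
     (inv_ratio m * f m m - f m.+1 m.+1).
  rewrite starCE opBE /inv_ratio cpow_half2 cpow_half3.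
  have q2 := qC_expn_neq1 1; have Q0 := qC_neq0.
  have qm : 1 - (Q ^+ 2) ^+ m.+1 != 0 by rewrite -exprM; exact: qC_expn_neq1.
  have Qm : Q ^+ m != 0 by rewrite expf_neq0.
  move: q2 qm; rewrite -!exprM !(mulnC 2) !exprM !exprVn !exprS.
  move: (cpow _ _) (cpow _ _) (Q ^+ m) Qm h0 => c d x x0 c0.
  by rewrite !expr0 !mulr1 => q2 qm; field; rewrite q2 qm x0 Q0.
have c_neq0 m : cpow q (iv / 2) / (1 - Q ^+ 2) * (Q^-1 ^+ m.+1 - Q ^+ m.+1) != 0.
  apply: mulf_neq0; last exact: qC_expnV_neq0.
  by apply: mulf_neq0 => //; rewrite invr_eq0; exact: (qC_expn_neq1 1).
split=> [E m|E].
  have /eqP := key m; rewrite E subrr eq_sym mulf_eq0 (negPf (c_neq0 m)) /=.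
  by rewrite subr_eq0 => /eqP.
apply/funext => m; apply/funext => n; case: m => [|m].
  by rewrite starC0E opBE f0// mul0r mulr0.
have [->|mn] := eqVneq n m.
  by apply/eqP; rewrite -subr_eq0 key E subrr mulr0.
rewrite starCE opBE f0 1?eq_sym// f0; last by rewrite eqSS eq_sym.
by rewrite !mul0r !mulr0.
Qed.

Lemma su2_invariantE (f : fps2 R) : su2_invariant q nu f <-> f = diag2 inv_coef.
Proof.
split=> [[f00 /starA_opAinv_diag f0 /(starC_opB_diag f0) fS]|->].
  apply/funext => m; apply/funext => n; rewrite /diag2.
  case: eqVneq => [<-{n}|/f0//]; elim: m => [|m IHm].
    by rewrite f00 /inv_coef big_ord0.
  by rewrite fS IHm /inv_coef big_ord_recr /= mulrC.
have d0 m n : m != n -> diag2 inv_coef m n = 0 by rewrite /diag2 => /negPf ->.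
split; first by rewrite /diag2 eqxx /inv_coef big_ord0.
  exact/starA_opAinv_diag.
apply/starC_opB_diag => // m.
by rewrite /diag2 !eqxx /inv_coef big_ord_recr /= mulrC.
Qed.

(** * Recursions for the hypergeometric factors and the Whittaker equation *)

Lemma qpochS (a p : C) n : qpoch a p n.+1 = qpoch a p n * (1 - a * p ^+ n).
Proof. by rewrite /qpoch big_ord_recr. Qed.

(** One recursion serves all the xi's, with (r, s) = (1, 0), (0, 1) or (3, 0). Zero parameters
    contribute 1, and (q,q)_n (-q,q)_n = (q^2,q^2)_n merges the two denominators. *)
Lemma basic_hyp0S r s n :
  let u := basic_hyp (nseq r 0) (nseq s 0 ++ [:: - Q]) Q in
  u n.+1 * (1 - (Q ^+ 2) ^+ n.+1) = u n * (- Q ^+ n) ^ (s.+2%:Z - r%:Z).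
Proof.
have poch0 m : qpoch 0 Q m = 1.
  by apply: big1 => i _; rewrite mul0r subr0.
have prod0 k m : \prod_(a <- nseq k (0 : C)) qpoch a Q m = 1.
  by rewrite big1_seq// => a /andP[_]; rewrite mem_nseq => /andP[_ /eqP ->].
have h2 : 1 - (Q ^+ 2) ^+ n.+1 = (1 - Q * Q ^+ n) * (1 - - Q * Q ^+ n).
  by rewrite -exprM mulnC exprM [Q ^+ n.+1]exprS; ring.
(* The nonvanishing of 1 - q^(2n+2) gives that of both its factors 1 - q^(n+1) and 1 + q^(n+1). *)
have := qC_expn_neq1 (n.*2.+1); rewrite -doubleS -mul2n exprM h2 mulf_eq0 negb_or.
move=> /andP[h3 h4].
rewrite /= /basic_hyp !big_cat/= !big_seq1 !prod0 !mul1r !qpochS.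
rewrite size_cat !size_nseq /= addn1.
have -> : (-1) ^+ n.+1 * Q ^+ 'C(n.+1, 2) =
    ((-1) ^+ n * Q ^+ 'C(n, 2)) * (- Q ^+ n).
  by rewrite binS bin1 exprS exprD; ring.
rewrite expfzMl !invfM; set k := (s.+2%:Z - r%:Z).
move: (_ ^ k) (_ ^ k) (qpoch _ _ _)^-1 (qpoch _ _ _)^-1 => *; field.
by rewrite h3 h4.
Qed.

(** The factor on the left is the one that the q-difference in B and B^* produces; it equals
    q^(-n-1) (1 - q^(2n+2)). *)
Lemma fps_dil_basic_hyp0S t r s n :
  let f := fps_dil t (basic_hyp (nseq r 0) (nseq s 0 ++ [:: - Q]) Q) in
  f n.+1 * (Q^-1 ^+ n.+1 - Q ^+ n.+1) =
  t * (- Q ^+ n) ^ (s.+2%:Z - r%:Z) * Q^-1 ^+ n.+1 * f n.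
Proof.
have -> : Q^-1 ^+ n.+1 - Q ^+ n.+1 = Q^-1 ^+ n.+1 * (1 - (Q ^+ 2) ^+ n.+1).
  rewrite mulrBr mulr1 -exprM mulnC exprM [(Q ^+ n.+1) ^+ 2]expr2 mulrA exprVn.
  by rewrite mulVf ?mul1r// expf_neq0// qC_neq0.
rewrite /= /fps_dil exprS.
transitivity (basic_hyp (nseq r 0) (nseq s 0 ++ [:: - Q]) Q n.+1 *
  (1 - (Q ^+ 2) ^+ n.+1) * (t * t ^+ n * Q^-1 ^+ n.+1)); first by ring.
by rewrite basic_hyp0S; ring.
Qed.

Lemma starB_opB_tens (a b : fps R) m n :
  starB q nu (opB q nu (tens a b)) m n = cpow q iv / (1 - Q ^+ 2) ^+ 2 *
    (a m.+1 * (Q^-1 ^+ m.+1 - Q ^+ m.+1)) * (b n.+1 * (Q^-1 ^+ n.+1 - Q ^+ n.+1)).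
Proof.
rewrite starBE opBE /tens {3}[iv](splitr iv) cpowD// expr2 invfM; ring.
Qed.

(** On a product the two q-differences decouple into first-order recursions. That of [xi1] has a
    constant factor; that of [xi2] carries q^(2n(1-delta)), which is the action of A^(2(delta-1)) on
    z^n up to a constant. The sign comes from i^2 = -1. *)
Lemma whittaker_xi (mu : R) (delta : nat) : (delta <= 2)%N ->
  whittaker q nu mu delta (tens (xi1 q nu mu) (xi2 q nu mu delta)).
Proof.
move=> d2; rewrite /whittaker; apply/funext => m; apply/funext => n.
rewrite starB_opB_tens.
have Q0 := qC_neq0; have q2 := qC_expn_neq1 1.
have Qm k : Q ^+ k != 0 by rewrite expf_neq0.
have i2 : 'i ^+ 2 = -1 :> C by exact: sqrCi.
have hiv := cpow_neq0 iv q_gt0.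
have E1 : cpow q (1 - iv) = Q / cpow q iv.
  by rewrite cpowD// cpowN// -[Q]expr1 -cpow_nat.
have E3 : cpow q (3 - iv) = Q ^+ 3 / cpow q iv.
  by rewrite cpowD// cpowN// -cpow_nat.
have E0 : cpow q (iv - 1) = cpow q iv / Q.
  by rewrite cpowD// cpowN// -[Q]expr1 -cpow_nat.
have Ehalf : cpow q ((iv - 1) / 2) ^+ 2 = cpow q iv / Q.
  by rewrite -E0 {2}[iv - 1]splitr cpowD.
have xi1S : xi1 q nu mu m.+1 * (Q^-1 ^+ m.+1 - Q ^+ m.+1) =
    'i * mu%:C * (1 - Q ^+ 2) / cpow q iv * xi1 q nu mu m.
  rewrite [LHS](fps_dil_basic_hyp0S _ 1 0) -/(xi1 q nu mu).
  rewrite E1 -exprnP expr1 exprVn [Q ^+ m.+1]exprS; move: (Qm m) => Qm0; field.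
  by rewrite Qm0 hiv Q0.
rewrite xi1S; case: delta d2 => [|[|[|//]]] _.
- have -> : xi2 q nu mu 0 n.+1 * (Q^-1 ^+ n.+1 - Q ^+ n.+1) =
      'i * mu%:C * (1 - Q ^+ 2) * Q ^+ 2 / cpow q iv * (Q ^+ n) ^+ 2 *
      xi2 q nu mu 0 n.
    rewrite [LHS](fps_dil_basic_hyp0S _ 0 1) -/(xi2 q nu mu 0).
    rewrite E3 -exprnP exprVn [Q ^+ n.+1]exprS; move: (Qm n) => Qn0; field.
    by rewrite Qn0 hiv Q0.
  (* For delta = 0 the exponent of A computes to -2, hence two applications of [opAinv]. *)
  transitivity (- (mu%:C ^+ 2 * Q) *
    opAinv q nu (opAinv q nu (tens (xi1 q nu mu) (xi2 q nu mu 0))) m n) => //.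
  rewrite !opAinvE /tens; move: Ehalf {E1 E3 E0 xi1S} hiv.
  move: (cpow q iv) (cpow q _) (xi1 _ _ _ _) (xi2 _ _ _ _ _) (Q ^+ n).
  move=> w c x y z cw w0.
  (* Everything is expressed through c = q^((i nu - 1)/2), so that only a rational identity is
     left. *)
  have {cw}wE : w = c ^+ 2 * Q by rewrite cw divfK.
  have c0 : c != 0 by apply: contra_neq w0 => c0; rewrite wE c0 expr0n mul0r.
  rewrite wE.
  transitivity ('i ^+ 2 * (mu%:C ^+ 2 * Q / c ^+ 2 * (x * y * z ^+ 2))).
    by field; rewrite q2 Q0 c0.
  by rewrite i2; field.
- have -> : xi2 q nu mu 1 n.+1 * (Q^-1 ^+ n.+1 - Q ^+ n.+1) =
      'i * mu%:C * (1 - Q ^+ 2) * xi2 q nu mu 1 n.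
    rewrite [LHS](fps_dil_basic_hyp0S _ 1 0) -/(xi2 q nu mu 1).
    rewrite -exprnP expr1 exprVn [Q ^+ n.+1]exprS; move: (Qm n) => Qn0; field.
    by rewrite Qn0 Q0.
  transitivity (- (mu%:C ^+ 2 * 1) * tens (xi1 q nu mu) (xi2 q nu mu 1) m n) => //.
  rewrite /tens; move: hiv {E1 E3 E0 xi1S Ehalf}.
  move: (cpow q _) (xi1 _ _ _ _) (xi2 _ _ _ _ _) => w x y w0.
  transitivity ('i ^+ 2 * (mu%:C ^+ 2 * (x * y))); first by field; rewrite q2 w0.
  by rewrite i2; field.
have -> : xi2 q nu mu 2 n.+1 * (Q^-1 ^+ n.+1 - Q ^+ n.+1) =
    'i * mu%:C * (1 - Q ^+ 2) * cpow q iv / Q ^+ 2 / (Q ^+ n) ^+ 2 *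
    xi2 q nu mu 2 n.
  rewrite [LHS](fps_dil_basic_hyp0S _ 3 0) -/(xi2 q nu mu 2).
  rewrite E0 exprN1 exprVn [Q ^+ n.+1]exprS; move: (Qm n) => Qn0; field.
  by rewrite Qn0 Q0.
transitivity (- (mu%:C ^+ 2 * Q^-1) *
  opA q nu (opA q nu (tens (xi1 q nu mu) (xi2 q nu mu 2))) m n) => //.
rewrite !opAE /tens exprVn; move: Ehalf (Qm n) {E1 E3 E0 xi1S} hiv.
move: (cpow q iv) (cpow q _) (xi1 _ _ _ _) (xi2 _ _ _ _ _) (Q ^+ n).
move=> w c x y z cw z0 w0.
have {cw}wE : w = c ^+ 2 * Q by rewrite cw divfK.
have c0 : c != 0 by apply: contra_neq w0 => c0; rewrite wE c0 expr0n mul0r.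
rewrite wE.
transitivity ('i ^+ 2 * (mu%:C ^+ 2 / Q * c ^+ 2 * (x * y / z ^+ 2))).
  by field; rewrite z0 Q0 c0.
by rewrite i2; field; rewrite Q0 z0.
Qed.

End InvariantVector.

(** * Limits, and inverses of formal power series *)

Lemma cvg_prod_ord (K : numFieldType) (u : nat -> nat -> K^o) (l : nat -> K^o) k :
  (forall j, u j @ \oo --> l j)%classic ->
  ((fun n => \prod_(j < k) u j n : K^o) @ \oo --> (\prod_(j < k) l j : K^o))%classic.
Proof.
move=> ul; elim: k => [|k IHk].
  rewrite big_ord0 (_ : (fun n : nat => _) = fun=> 1); first exact: cvg_cst.
  by apply/funext => n; rewrite big_ord0.
rewrite big_ord_recr /= (_ : (fun n : nat => _) =
    (fun n => \prod_(j < k) u j n) \* u k).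
  exact: cvgM.
by apply/funext => n; rewrite big_ord_recr.
Qed.

Lemma cvg_affine (K : numFieldType) (x : nat -> K^o) (l a b c : K^o) :
  (x @ \oo --> l)%classic ->
  ((fun n => a * (x n - b) * c : K^o) @ \oo --> (a * (l - b) * c : K^o))%classic.
Proof.
move=> xl; apply: cvgM; last exact: cvg_cst.
by apply: cvgM; [exact: cvg_cst|apply: cvgB => //; exact: cvg_cst].
Qed.

Lemma cvg_realC (R : realType) (T : Type) (F : set_system T) (FF : Filter F)
    (u : T -> R) (l : R) :
  (u @ F --> l)%classic ->
  ((fun x => (u x)%:C : R[i]^o) @ F --> (l%:C : R[i]^o))%classic.
Proof.
move=> /cvgrPdist_lt ul; apply/cvgrPdist_lt => e e_gt0.
(* In the order of [R[i]] a positive element is real, so the radius e descends to R. *)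
have eE : e = (complex.Re e)%:C by rewrite RRe_real// gtr0_real.
have re_gt0 : 0 < complex.Re e by rewrite -ltcR -eE.
apply: filterS (ul _ re_gt0) => x; rewrite -ltcR -eE; apply: le_lt_trans.
by rewrite -rmorphB normc_def /= expr0n addr0 sqrtr_sqr.
Qed.

(** Modulo X^(n+1) the truncation F has two inverses: G by hypothesis, and the geometric sum S
    because X divides 1 - F. They agree since S = G (F S) - (F G - 1) S. *)
Lemma fps_inv_unique (R : realType) (f g : fps R) : f 0%N = 1 ->
  (forall n, fps_mul f g n = (n == 0%N)%:R) -> fps_inv f = g.
Proof.
move=> f0 fg; apply/funext => n; rewrite /fps_inv.
set F := \poly_(i < n.+1) f i; set S := \sum_(k < n.+1) _.
pose G := \poly_(i < n.+1) g i.
have FGE i : (i <= n)%N -> (F * G)`_i = (i == 0%N)%:R.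
  move=> i_le_n; rewrite -fg coefM; apply: eq_bigr => j _.
  rewrite !coef_poly !ltnS (leq_trans (leq_ord j))// ?(leq_trans (leq_subr _ _))//.
have [D FGD] : exists D : {poly R[i]}, F * G = 1 + D * 'X^(n.+1).
  exists (drop_poly n.+1 (F * G)); rewrite -{1}[F * G](poly_take_drop n.+1).
  congr (_ + _); apply/polyP => i; rewrite coef_take_poly coef1 ltnS.
  by case: leqP => [/FGE//|]; case: i.
have [v uE] : exists v : {poly R[i]}, 1 - F = v * 'X.
  have /factor_theorem[v vE] : root (1 - F) 0.
    by rewrite /root horner_coef0 coefB coef1 coef_poly /= f0 subrr.
  by exists v; rewrite vE subr0.
have FS : F * S = 1 - v ^+ n.+1 * 'X^(n.+1).
  rewrite -exprMn -uE -[LHS]opprK -[RHS]opprK opprB subrX1; congr (- _).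
  by rewrite -mulNr; congr (_ * _); rewrite addrC addKr.
have SE : S = G - (G * v ^+ n.+1 + D * S) * 'X^(n.+1).
  transitivity (G * (F * S) - (F * G - 1) * S); first by ring.
  by rewrite FS FGD; ring.
by rewrite SE coefB coefMXn ltnSn subr0 coef_poly ltnSn.
Qed.

(** * The q-binomial theorem for formal power series *)

Section QBinomial.
Variables (R : realType) (p : R).
Hypotheses (p_gt0 : 0 < p) (p_lt1 : p < 1).
Local Notation C := R[i].
Local Notation P := (p%:C : C).

Let pC_expn_neq1 n : 1 - P ^+ n.+1 != 0.
Proof.
rewrite subr_eq0 eq_sym -rmorphXn /= fmorph_eq1 lt_eqF//.
by rewrite exprn_ilt1// ltW.
Qed.

(** The finite q-binomial theorem, in a form where n enters only through p^n, so that the limit can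
    be taken factor by factor. For k > n the factor j = n vanishes, as it should. *)
Lemma coef_qpochX (c : C) n k :
  (\prod_(j < n) (1 - (c * P ^+ j) *: 'X))`_k =
  \prod_(j < k) (c * (P ^+ n - P ^+ j) / (1 - P ^+ j.+1)).
Proof.
pose W n := \prod_(j < n) (1 - (c * P ^+ j) *: 'X).
have W0 m : (W m)`_0 = 1.
  elim: m => [|m IHm]; rewrite /W ?big_ord0 ?coef1// big_ord_recr /= coef0M.
  by rewrite IHm coefB coefZ coefX coef1 mulr0 subr0 mul1r.
have WS m i : (W m.+1)`_i.+1 = (W m)`_i.+1 - c * P ^+ m * (W m)`_i.
  rewrite /W big_ord_recr /= mulrBr mulr1 -scalerAr coefB coefZ.
  by rewrite coefMX.
have key m i : (W m)`_i.+1 * (1 - P ^+ i.+1) = c * (W m)`_i * (P ^+ m - P ^+ i).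
  elim: m i => [|m IHm] i.
    rewrite /W big_ord0 !coef1 mul0r; case: i => [|i]; first by rewrite subrr mulr0.
    by rewrite mulr0 mul0r.
  rewrite WS mulrBl IHm; case: i => [|i].
    by rewrite !W0 [P ^+ m.+1]exprS; move: (P ^+ m) => x; ring.
  (* The induction hypothesis at i + 1 has been used; what remains is -c p^(m+1) times the one at
     i. *)
  rewrite WS; have := IHm i; move: (W m)`_i.+1 (W m)`_i => x y xy.
  apply/eqP; rewrite -subr_eq0; apply/eqP.
  transitivity (- c * P ^+ m * P *
      (x * (1 - P ^+ i.+1) - c * y * (P ^+ m - P ^+ i))).
    by rewrite !exprS; move: (P ^+ m) (P ^+ i) => ? ?; ring.
  by rewrite xy subrr mulr0.
rewrite -/(W n); elim: k => [|k IHk]; first by rewrite W0 big_ord0.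
rewrite big_ord_recr /= -IHk; apply: (mulIf (pC_expn_neq1 k)).
by rewrite key mulrA divfK//; ring.
Qed.

Lemma cvg_expC0 : ((fun n => P ^+ n : C^o) @ \oo --> (0 : C^o))%classic.
Proof.
have := @cvg_realC R nat \oo%classic _ (fun n => p ^+ n) 0.
rewrite (_ : (fun n => (p ^+ n)%:C : C^o) = (fun n => P ^+ n)).
  by apply; apply: cvg_expr; rewrite ger0_norm// ltW.
by apply/funext => n; rewrite rmorphXn.
Qed.

(** Euler's expansion of (c x, p)_oo, obtained by letting p^n tend to 0 in the finite formula. *)
Lemma qpoch_inf_fpsE (c : C) k :
  qpoch_inf_fps c P k = \prod_(j < k) (- c * P ^+ j / (1 - P ^+ j.+1)).
Proof.
rewrite /qpoch_inf_fps; apply: (@norm_cvg_lim C C^o).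
rewrite (_ : (fun n : nat => _) = fun n =>
  \prod_(j < k) (c * (P ^+ n - P ^+ j) / (1 - P ^+ j.+1))); last first.
  by apply/funext => n; rewrite coef_qpochX.
pose u (j n : nat) : C^o := c * (P ^+ n - P ^+ j) / (1 - P ^+ j.+1).
pose l (j : nat) : C^o := - c * P ^+ j / (1 - P ^+ j.+1).
apply: (@cvg_prod_ord C u l k) => j.
have -> : l j = c * (0 - P ^+ j) * (1 - P ^+ j.+1)^-1 by rewrite /l; ring.
exact: (@cvg_affine C _ _ _ _ _ cvg_expC0).
Qed.

(** The second factor is Euler's series for 1 / (c x, p)_oo. The first-order recursions [ES] and
    [GS] of the factors combine into the recursion [WS] of their product. *)
Lemma q_binomial (c d : C) n :
  fps_mul (qpoch_inf_fps d P) (fun k => \prod_(j < k) (c / (1 - P ^+ j.+1))) n =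
  \prod_(j < n) ((c - d * P ^+ j) / (1 - P ^+ j.+1)).
Proof.
pose E := qpoch_inf_fps d P; pose G k := \prod_(j < k) (c / (1 - P ^+ j.+1)).
have DM a b k : a * (b / (1 - P ^+ k.+1)) * (1 - P ^+ k.+1) = b * a.
  by rewrite -mulrA divfK// mulrC.
have ES k : E k.+1 * (1 - P ^+ k.+1) = - d * P ^+ k * E k.
  by rewrite /E !qpoch_inf_fpsE big_ord_recr /= DM.
have GS k : G k.+1 * (1 - P ^+ k.+1) = c * G k.
  by rewrite /G big_ord_recr /= DM.
have WS m : fps_mul E G m.+1 * (1 - P ^+ m.+1) = (c - d * P ^+ m) * fps_mul E G m.
  (* Splits 1 - p^(m+1) as (1 - p^(m+1-i)) + p^(m+1-i) (1 - p^i). Each sum then loses one end term,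
     and its shifted index runs over the product at m. *)
  transitivity (\sum_(i < m.+2) (E i * (G (m.+1 - i)%N * (1 - P ^+ (m.+1 - i)))) +
    \sum_(i < m.+2) (P ^+ (m.+1 - i) * (E i * (1 - P ^+ i)) * G (m.+1 - i)%N)).
    rewrite /fps_mul mulr_suml -big_split /=; apply: eq_bigr => i _.
    have -> : P ^+ m.+1 = P ^+ (m.+1 - i) * P ^+ i.
      by rewrite -exprD subnK// leq_ord.
    by move: (P ^+ i) (P ^+ (_ - _)) => ? ?; ring.
  rewrite big_ord_recr /= subnn subrr !mulr0 addr0.
  rewrite [X in _ + X]big_ord_recl /= subrr !mulr0 mul0r add0r.
  rewrite mulrBl /fps_mul !mulr_sumr -sumrN; congr (_ + _); apply: eq_bigr => i _.
    by rewrite subSn ?leq_ord// GS; ring.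
  have -> : P ^+ m = P ^+ (m - i) * P ^+ i by rewrite -exprD subnK// leq_ord.
  rewrite /bump /= add1n subSS ES.
  by move: (P ^+ i) (P ^+ (_ - _)) => ? ?; ring.
rewrite -/E -/G; elim: n => [|n IHn].
  by rewrite /fps_mul big_ord1 /E qpoch_inf_fpsE /G !big_ord0 mulr1.
by apply: (mulIf (pC_expn_neq1 n)); rewrite WS IHn big_ord_recr /= DM.
Qed.

Lemma q_binomial_ratio (c d : C) n :
  fps_mul (qpoch_inf_fps d P) (fps_inv (qpoch_inf_fps c P)) n =
  \prod_(j < n) ((c - d * P ^+ j) / (1 - P ^+ j.+1)).
Proof.
rewrite (@fps_inv_unique _ _ (fun k => \prod_(j < k) (c / (1 - P ^+ j.+1)))).
- exact: q_binomial.
- by rewrite qpoch_inf_fpsE big_ord0.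
(* For d = c the factor j = 0 is c - c, so all coefficients of positive degree vanish. *)
- move=> [|m]; rewrite q_binomial ?big_ord0//.
  by rewrite big_ord_recl /= expr0 mulr1 subrr !mul0r.
Qed.

End QBinomial.

(** * Estimates for power series and convergence of a real infinite product *)

Lemma sum_geometric_le (K : numFieldType) (x : K) n :
  0 <= x -> 2 * x <= 1 -> \sum_(m < n) x ^+ m.+1 <= 2 * x.
Proof.
move=> x_ge0 x_le; elim: n => [|n IHn]; first by rewrite big_ord0 mulr_ge0.
rewrite big_ord_recl /= expr1 mulr_natl mulr2n lerD2l.
under eq_bigr => i _ do rewrite /bump /= add1n exprS.
by rewrite -mulr_sumr ler_piMr// (le_trans IHn).
Qed.

(** The bound is uniform in n, so it can be used at whatever truncation the convergence of the
    series provides. *)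
Lemma sum_pow_near1 (K : numFieldType) (a : nat -> K) (M t : K) n :
  a 0%N = 1 -> (forall m, `|a m| <= M ^+ m) -> 2 * (M * `|t|) <= 1 ->
  0 <= M -> `|\sum_(m < n.+1) a m * t ^+ m - 1| <= 2 * (M * `|t|).
Proof.
move=> a0 aM Mt M_ge0.
rewrite big_ord_recl a0 /= expr0 mulr1 addrAC subrr add0r.
apply: le_trans (ler_norm_sum _ _ _) _.
apply: le_trans (@sum_geometric_le _ _ n _ Mt); last by rewrite mulr_ge0.
apply: ler_sum => i _; rewrite /bump /= add1n normrM normrX exprMn.
by rewrite ler_wpM2r ?exprn_ge0.
Qed.

Lemma cvg_mulV (K : numFieldType) (c d : K^o) (u v : nat -> K^o) :
  (u @ \oo --> d)%classic -> (v @ \oo --> (1 : K^o))%classic ->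
  ((fun n => c * u n * (v n)^-1) @ \oo --> c * d)%classic.
Proof.
move=> ud v1; rewrite -[c * d]mulr1 -[X in _ * X]invr1.
by apply: cvgM; [exact: cvgMl_tmp|apply: cvgV => //; exact: oner_neq0].
Qed.

Section RealProduct.
Variables (R : realType) (s p : R).
Hypotheses (s_ge0 : 0 <= s) (p_ge0 : 0 <= p) (p_lt1 : p < 1).

Let D n : R := \prod_(j < n) (1 + s * p ^+ j).

Let DS n : D n.+1 = D n * (1 + s * p ^+ n).
Proof. by rewrite /D big_ord_recr. Qed.

Let D_ge1 n : 1 <= D n.
Proof.
elim: n => [|n IHn]; first by rewrite /D big_ord0.
by rewrite DS mulr_ege1// lerDl mulr_ge0// exprn_ge0.
Qed.

(** The partial products increase and, by 1 + x <= exp x, stay below the exponential of a geometric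
    sum. The bound d >= 1 later allows division by the limit. *)
Lemma cvg_real_product : exists2 d : R, 1 <= d & (D @ \oo --> d)%classic.
Proof.
have D_le n : D n <= expR (s * (1 - p ^+ n) / (1 - p)).
  elim: n => [|n IHn]; first by rewrite /D big_ord0 expr0 subrr mulr0 mul0r expR0.
  have -> : s * (1 - p ^+ n.+1) / (1 - p) = s * (1 - p ^+ n) / (1 - p) + s * p ^+ n.
    have p1 : 1 - p != 0 by rewrite subr_eq0 gt_eqF.
    rewrite exprS; field; exact: p1.
  rewrite DS expRD ler_pM ?expR_ge1Dx ?(le_trans ler01)// .
  by rewrite lerDl mulr_ge0// exprn_ge0.
have Dcvg : cvgn D.
  apply: nondecreasing_is_cvgn.
    apply/nondecreasing_seqP => n; rewrite DS ler_peMr ?(le_trans ler01)//.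
    by rewrite lerDl mulr_ge0// exprn_ge0.
  exists (expR (s / (1 - p))) => _ [n _ <-]; apply: le_trans (D_le n) _.
  rewrite ler_expR ler_wpM2r//; first by rewrite invr_ge0 subr_ge0 ltW.
  by rewrite ler_piMr// gerBl exprn_ge0.
exists (limn D) => //; apply: limr_ge => //; exact: nearW.
Qed.

End RealProduct.

Lemma qpoch_inf_real (R : realType) (s p : R) :
  0 <= s -> 0 <= p -> p < 1 ->
  exists2 d : R[i], d != 0 &
    ((fun n => qpoch (- s%:C) p%:C n : R[i]^o) @ \oo --> (d : R[i]^o))%classic.
Proof.
move=> s_ge0 p_ge0 p_lt1.
have [d d_ge1 dD] := cvg_real_product s_ge0 p_ge0 p_lt1.
exists d%:C; first by rewrite fmorph_eq0 gt_eqF// (lt_le_trans ltr01).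
rewrite (_ : (fun n => _) = fun n => (\prod_(j < n) (1 + s * p ^+ j))%:C).
  exact: cvg_realC dD.
apply/funext => n; rewrite /qpoch rmorph_prod; apply: eq_bigr => j _.
by rewrite rmorphD rmorph1 rmorphM rmorphXn mulNr opprK.
Qed.

(** * The invariant vector as a function, and its conjugate *)

Section InvariantFunction.
Variables (R : realType) (q nu : R).
Hypotheses (q_gt0 : 0 < q) (q_lt1 : q < 1).
Local Notation C := R[i].
Local Notation Q := (q%:C : C).
Local Notation iv := (inu nu).
Local Notation w := (cpow q (2 - 2 * iv)).

Let Q_gt0 : 0 < Q. Proof. by rewrite ltcR. Qed.
Let Q_ge0 : 0 <= Q. Proof. by rewrite ltW. Qed.
Let Q_lt1 : Q < 1. Proof. by rewrite ltcR. Qed.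

(** Each ratio has numerator at most q^2 (1 + |w|) and denominator at least 1 - q^2 in modulus. *)
Lemma inv_coef_bound : exists2 M : C, 0 < M &
  forall m, `|inv_coef q nu m| <= M ^+ m.
Proof.
have q2 : 0 < 1 - Q ^+ 2 by rewrite subr_gt0 exprn_ilt1.
pose M := Q ^+ 2 * (1 + `|w|) / (1 - Q ^+ 2).
have M_gt0 : 0 < M.
  by rewrite !mulr_gt0 ?invr_gt0 ?exprn_gt0// ltr_wpDr.
exists M => // m; rewrite /inv_coef normr_prod.
rewrite -[m in M ^+ m]card_ord -prodr_const; apply: ler_prod => j _.
rewrite normr_ge0 /= /inv_ratio /M; move: (w) => b.
rewrite !normrM normfV normrN.
have Qj : 0 <= (Q ^+ 2) ^+ j <= 1.
  by rewrite -exprM exprn_ge0// exprn_ile1// ltW.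
have /andP[Qj0 Qj1] := Qj.
have Q20 : 0 <= Q ^+ 2 by rewrite exprn_ge0.
rewrite [`|Q ^+ 2|]ger0_norm// ler_pM ?mulr_ge0 ?invr_ge0//.
  rewrite ler_wpM2l//; apply: le_trans (ler_normB _ _) _.
  rewrite normr1 lerD2l normrM [`|(_ ^+ j : C)|]ger0_norm//.
  by rewrite ler_piMr.
have le1 : 1 - Q ^+ 2 <= 1 - (Q ^+ 2) ^+ j.+1.
  by rewrite lerD2l lerN2 exprS ler_piMr.
by rewrite ger0_norm ?(le_trans (ltW q2))// lef_pV2// posrE (lt_le_trans q2).
Qed.

Lemma conjc_inu : conjc iv = - iv.
Proof.
apply/eqP; rewrite /inu -complexiE eq_complex /=.
by apply/andP; split; apply/eqP; ring.
Qed.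

Lemma mulr_conjc_cpow : Q ^+ 2 * conjc w = cpow q (2 * iv + 4).
Proof.
rewrite conjc_cpow -cpow_nat// -cpowD//; congr cpow.
have conjM (x y : C) : conjc (x * y) = conjc x * conjc y by exact: rmorphM.
have conjB (x y : C) : conjc (x - y) = conjc x - conjc y by exact: rmorphB.
by rewrite conjB conjM conjc_inu conjc_nat; ring.
Qed.

(** The q-binomial theorem with p = q^2, c = -q^2 and d = -q^(2 i nu + 4); conjugation has replaced
    i nu by -i nu. *)
Lemma conjc_inv_coef n : conjc (inv_coef q nu n) = fps_mul
  (qpoch_inf_fps (- cpow q (2 * iv + 4)) (Q ^+ 2))
  (fps_inv (qpoch_inf_fps (- Q ^+ 2) (Q ^+ 2))) n.
Proof.
have qE : Q ^+ 2 = (q ^+ 2)%:C by rewrite rmorphXn.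
rewrite [in RHS]qE q_binomial_ratio ?exprn_gt0 ?exprn_ilt1 ?ltW//.
rewrite -qE /inv_coef rmorph_prod; apply: eq_bigr => j _.
have Q2J : conjc (Q ^+ 2) = Q ^+ 2 by rewrite qE; exact: conjc_real.
rewrite -mulr_conjc_cpow /inv_ratio; move: (w) (Q ^+ 2) Q2J => b p pJ.
rewrite fmorph_div rmorphM rmorphN !rmorphB !rmorphM !rmorphXn rmorph1 /= pJ.
by congr (_ / _); ring.
Qed.

Variable F : C -> C -> C.
Hypothesis invF : invariant_function q nu (diag2 (inv_coef q nu)) F.

Let shift zb z : 0 < zb * z -> F (Q * zb) z = F zb (Q * z).
Proof.
move=> t0; have Qt0 : 0 < Q * zb * z by rewrite -mulrA mulr_gt0.
have [+ _] := invF.2 (Q * zb) z Qt0.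
by rewrite /fun_starA /fun_opAinv mulVKf ?cpow_neq0// mulKf ?qC_neq0.
Qed.

(** The equation for C and B is taken at (q zb, z). There [shift] reduces the four values of F to
    F(zb, z) and F(q^2 zb, z). *)
Lemma invariant_function_step zb z : 0 < zb * z ->
  F zb z * (1 + Q ^+ 2 * (zb * z)) =
  F (Q * (Q * zb)) z * (1 + Q ^+ 2 * w * (zb * z)).
Proof.
move=> t0; have Q0 := qC_neq0 q_gt0.
have Qt0 : 0 < Q * zb * z by rewrite -mulrA mulr_gt0.
have z0 : z != 0 by apply: contraTneq t0 => ->; rewrite mulr0 ltxx.
have [_ +] := invF.2 (Q * zb) z Qt0.
rewrite /fun_starC /fun_opB mulKf// -(shift Qt0).
have -> : F (Q * zb) (Q^-1 * z) = F zb z.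
  rewrite shift ?mulVKf//.
  by rewrite mulrCA mulr_gt0// invr_gt0.
have h0 := cpow_neq0 (iv / 2) q_gt0.
rewrite cpow_half2// cpow_half3//.
have q2 := qC_expn_neq1 q_gt0 q_lt1 1.
move: (F zb z) (F (Q * (Q * zb)) z) (cpow q (2 - 2 * iv)) (cpow q (iv / 2)) h0.
move=> f g b c c0 E.
apply/eqP; rewrite -subr_eq0; apply/eqP.
transitivity ((1 - Q ^+ 2) * z / c *
  (c * ((f - g) / (1 - Q ^+ 2)) / z -
   Q * zb / (1 - Q ^+ 2) * (- (c * Q) * f + c * Q * b * g))).
  by field; rewrite q2 c0 z0.
by rewrite E subrr mulr0.
Qed.

(** By [shift] each factor q^2 is shared equally between zb and z, so both arguments tend to 0 while
    t is multiplied by q^2. *)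
Lemma invariant_function_iter zb z n : 0 < zb * z ->
  F zb z * qpoch (- Q ^+ 2 * (zb * z)) (Q ^+ 2) n =
  F (Q ^+ n * zb) (Q ^+ n * z) * qpoch (- Q ^+ 2 * w * (zb * z)) (Q ^+ 2) n.
Proof.
move=> t0; elim: n => [|n IHn]; first by rewrite /qpoch !big_ord0 !expr0 !mul1r.
rewrite !qpochS mulrA IHn.
set G := qpoch (- Q ^+ 2 * w * _) _ _; set zbn := Q ^+ n * zb; set zn := Q ^+ n * z.
have Qn_gt0 : 0 < Q ^+ n by rewrite exprn_gt0.
have tn : zbn * zn = (Q ^+ 2) ^+ n * (zb * z).
  by rewrite /zbn /zn mulrACA -expr2 -!exprM mulnC.
have tn0 : 0 < zbn * zn.
  by rewrite tn; exact: mulr_gt0 (exprn_gt0 _ (exprn_gt0 _ Q_gt0)) t0.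
have tn1 : 0 < Q * zbn * zn by rewrite -mulrA mulr_gt0.
have := invariant_function_step tn0; rewrite shift// tn.
have SE x : Q ^+ n.+1 * x = Q * (Q ^+ n * x) by rewrite exprS mulrA.
rewrite !SE -/zbn -/zn.
move: (F zbn zn) (F _ (Q * zn)) (Q ^+ 2) ((Q ^+ 2) ^+ n) (w) G (zb * z).
move=> f g p pn b G t E.
transitivity (f * (1 + p * (pn * t)) * G); first by ring.
by rewrite E; ring.
Qed.

Lemma cvg_invariant_function zb z : 0 < zb * z ->
  ((fun n => F (Q ^+ n * zb) (Q ^+ n * z) : C^o) @ \oo --> (1 : C^o))%classic.
Proof.
move=> t0; have [r r0 Fr] := invF.1; have [M M0 aM] := inv_coef_bound.
have small (c d : C) : 0 < d -> (\forall n \near \oo, `|Q ^+ n * c| < d)%classic.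
  move=> d0.
  have : ((fun n => Q ^+ n * c : C^o) @ \oo --> (0 : C^o))%classic.
    rewrite -[X in (_ --> (X : C^o))%classic](mul0r c).
    by apply: (@cvgMr_tmp C); exact: cvg_expC0.
  by move=> /cvgrPdist_lt /(_ _ d0); apply: filterS => n; rewrite sub0r normrN.
apply/cvgrPdist_lt => e e0.
(* Threshold for |t| that makes the bound 2 M |t| of [sum_pow_near1] less than e / 2; the other half
   of e is for the truncation of the series. *)
pose e' : C := e / 2 / (2 * M).
have M20 : 0 < 2 * M by rewrite mulr_gt0.
have e'0 : 0 < e' by rewrite !divr_gt0.
near=> n.
have nz : `|Q ^+ n * z| < r by near: n; exact: small.
have nzb : `|Q ^+ n * zb| < r by near: n; exact: small.
set t := (Q ^+ n * zb) * (Q ^+ n * z).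
have tE : `|t| <= `|Q ^+ n * (zb * z)|.
  rewrite /t mulrACA -mulrA normrM ler_piMl// normrX exprn_ile1//.
  by rewrite ger0_norm// ltW.
have t1 : 2 * M * `|t| <= 1.
  rewrite mulrC -ler_pdivlMr// mul1r (le_trans tE)// ltW//; near: n.
  by apply: small; rewrite invr_gt0.
have t2 : 2 * M * `|t| < e / 2.
  rewrite mulrC -ltr_pdivlMr// (le_lt_trans tE)//; near: n.
  exact: small.
have /cvgrPdist_lt /(_ (e / 2)) := Fr _ _ nzb nz.
(* The truncation at N + 1 is sure to contain the constant term. *)
rewrite divr_gt0// => /(_ isT) [N _ /(_ N.+1 (leqnSn N))] /=.
have -> : \sum_(m < N.+1) \sum_(k < N.+1)
    diag2 (inv_coef q nu) m k * (Q ^+ n * zb) ^+ m * (Q ^+ n * z) ^+ k =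
    \sum_(m < N.+1) inv_coef q nu m * t ^+ m.
  apply: eq_bigr => m _; rewrite (bigD1 m)//= big1.
    by rewrite addr0 /diag2 eqxx -mulrA -exprMn.
  by move=> k; rewrite eq_sym -val_eqE /= => /negPf km; rewrite /diag2 km !mul0r.
move=> FS; have := @sum_pow_near1 C (inv_coef q nu) M t N.
rewrite /inv_coef big_ord0 mulrA => /(_ erefl aM t1 (ltW M0)) S1.
rewrite distrC [e]splitr.
rewrite -(subrKA (\sum_(m < N.+1) inv_coef q nu m * t ^+ m)).
by rewrite (le_lt_trans (ler_normD _ _))// ltrD// (le_lt_trans S1).
Unshelve. all: by end_near. Qed.

Lemma invariant_function_conj z :
  conjc (F (conjc z) z) =
  qpoch_inf (- cpow q (2 * iv + 4) * conjc z * z) (Q ^+ 2) /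
  qpoch_inf (- Q ^+ 2 * conjc z * z) (Q ^+ 2).
Proof.
have qinf0 : qpoch_inf 0 (Q ^+ 2) = 1 :> C.
  rewrite /qpoch_inf; apply: (@norm_cvg_lim C C^o).
  rewrite (_ : (fun n : nat => _) = cst 1); first exact: cvg_cst.
  by apply/funext => n; apply: big1 => i _; rewrite mul0r subr0.
(* At z = 0 the invariance equations, which require t > 0, say nothing; the value comes from the
   power series. *)
have [->|z_neq0] := eqVneq z 0.
  rewrite conjc0 !mulr0 qinf0 divr1.
  have [r r0 /(_ 0 0)] := invF.1; rewrite !normr0 => /(_ r0 r0) F00.
  suff -> : F 0 0 = 1 by rewrite conjc1.
  rewrite -(@norm_cvg_lim C C^o _ _ _ F00); apply: (@norm_cvg_lim C C^o).
  (* The empty partial sum is skipped; all later ones equal 1. *)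
  rewrite -(cvg_shiftn 1) (_ : (fun n : nat => _) = cst 1).
    exact: cvg_cst.
  apply/funext => n; rewrite addn1 big_ord_recl big_ord_recl /= !expr0 !mulr1.
  rewrite big1 ?addr0; last by move=> i _; rewrite expr0n /= mulr0.
  rewrite big1 ?addr0; first by rewrite /diag2 eqxx /inv_coef big_ord0.
  by move=> i _; rewrite big1// => j _; rewrite expr0n /= mulr0 mul0r.
pose t := conjc z * z.
have t0 : 0 < t by rewrite /t mulrC -sqr_normc exprn_gt0// normr_gt0.
have [s tE] : exists s, t = s%:C.
  by exists (complex.Re t); rewrite RRe_real// gtr0_real.
have s0 : 0 < s by rewrite -ltcR -tE.
have qE : Q ^+ 2 = (q ^+ 2)%:C by rewrite rmorphXn.
have [d d0 dD] : exists2 d : C, d != 0 &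
    ((fun n => qpoch (- Q ^+ 2 * t) (Q ^+ 2) n : C^o) @ \oo --> (d : C^o))%classic.
  have -> : - Q ^+ 2 * t = - (q ^+ 2 * s)%:C by rewrite rmorphM /= tE qE mulNr.
  rewrite qE; apply: qpoch_inf_real.
  - by rewrite mulr_ge0 ?exprn_ge0 ?ltW.
  - by rewrite exprn_ge0 ?ltW.
  - by rewrite exprn_ilt1 ?ltW.
pose f := conjc (F (conjc z) z).
pose g n : C^o := conjc (F (Q ^+ n * conjc z) (Q ^+ n * z)).
pose N n : C^o := qpoch (- cpow q (2 * iv + 4) * t) (Q ^+ 2) n.
have Q2J : conjc (Q ^+ 2) = Q ^+ 2 by rewrite qE; exact: conjc_real.
have tJ : conjc t = t by rewrite tE; exact: conjc_real.
have conjM (x y : C) : conjc (x * y) = conjc x * conjc y by exact: rmorphM.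
have wJ := mulr_conjc_cpow.
have conj_poch a n : conjc (qpoch a (Q ^+ 2) n) = qpoch (conjc a) (Q ^+ 2) n.
  move: (Q ^+ 2) Q2J => p pJ; rewrite /qpoch rmorph_prod; apply: eq_bigr => j _.
  by rewrite rmorphB rmorph1 rmorphM rmorphXn /= pJ.
have iter n : f * qpoch (- Q ^+ 2 * t) (Q ^+ 2) n = g n * N n.
  have := congr1 conjc (invariant_function_iter n t0).
  have Q2NJ : conjc (- Q ^+ 2) = - Q ^+ 2 by rewrite -[in RHS]Q2J; exact: rmorphN.
  rewrite conjM conj_poch [X in qpoch X]conjM Q2NJ tJ => ->.
  rewrite conjM conj_poch [X in qpoch X]conjM tJ [X in qpoch (X * _)]conjM Q2NJ.
  by rewrite mulNr wJ.
have g1 : (g @ \oo --> (1 : C^o))%classic.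
  apply/cvgrPdist_lt => e e0.
  have /cvgrPdist_lt /(_ _ e0) := cvg_invariant_function t0.
  apply: filterS => n; rewrite /g -[X in X - conjc _]conjc1 -rmorphB.
  by rewrite normcJ.
have Nf : (N @ \oo --> (f * d : C^o))%classic.
  (* By [iter], the numerator N n is f times the partial denominator over g n as soon as g n is
     nonzero, which holds eventually because g tends to 1. *)
  have := @cvg_mulV C f d _ g dD g1; apply: cvg_trans; apply: near_eq_cvg.
  have := g1 => /cvgrPdist_lt /(_ 1 ltr01).
  apply: filterS => n g1n; rewrite iter mulrC mulKf//.
  by apply: contraTneq g1n => ->; rewrite subr0 normr1 ltxx.
rewrite /qpoch_inf -!mulrA -/t.
rewrite (@norm_cvg_lim C C^o _ _ _ Nf) (@norm_cvg_lim C C^o _ _ _ dD).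
by rewrite mulfK.
Qed.

End InvariantFunction.

(** * The matrix element *)

Lemma mul2_act_g (R : realType) (nu H : R) (s t : R[i]) (g : fps2 R) (a b : fps R) :
  mul2 g (dil2 s t (act_g nu H (tens a b))) =
  cpow H (inu nu - 1) *:
    mul2 g (tens (fps_dil s a) (fps_dil (t * H%:C ^- 2) b)).
Proof.
apply/funext => m; apply/funext => n.
transitivity (cpow H (inu nu - 1) *
    mul2 g (tens (fps_dil s a) (fps_dil (t * H%:C ^- 2) b)) m n) => //.
rewrite /mul2 mulr_sumr; apply: eq_bigr => i _; rewrite mulr_sumr.
apply: eq_bigr => j _; rewrite /tens /fps_dil.
have -> x y : dil2 s t (act_g nu H (tens a b)) x y =
    cpow H (inu nu - 1) * (a x * b y * 1 ^+ x * (H%:C ^- 2) ^+ y) * s ^+ x * t ^+ y.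
  by [].
rewrite expr1n mulr1 exprMn; move: (cpow _ _) (_ ^+ _) (_ ^+ _) (_ ^+ _) => *; ring.
Qed.

Theorem proposition6p2 (R : realType) (q nu mu H : R) (delta : nat)
    (q_gt0 : 0 < q) (q_lt1 : q < 1) (H_gt0 : 0 < H) (delta_le2 : (delta <= 2)%N) :
  (exists! psiL : fps2 R, su2_invariant q nu psiL) /\
  whittaker q nu mu delta (tens (xi1 q nu mu) (xi2 q nu mu delta)) /\
  forall psiL : fps2 R, su2_invariant q nu psiL ->
    (* power series understood formally *)
    (forall int2 : fps2 R -> R[i], homogeneous int2 ->
       herm q nu int2 psiL
         (act_g nu H (tens (xi1 q nu mu) (xi2 q nu mu delta)))
       = cpow q (inu nu - 1) * cpow H (inu nu - 1) *
         int2 (mul2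
           (diag2 (fps_mul
             (qpoch_inf_fps (- cpow q (2 * inu nu + 4)) (q%:C ^+ 2))
             (fps_inv (qpoch_inf_fps (- q%:C ^+ 2) (q%:C ^+ 2)))))
           (tens (fps_dil (cpow q (inu nu + 1)) (xi1 q nu mu))
                 (fps_dil (cpow q (inu nu - 1) * H%:C ^- 2)
                    (xi2 q nu mu delta))))) /\
    (* convergent power series and functions on the complex plane; int2 may be
       the Lebesgue integral plane_int, see plane_int_homogeneous *)
    ((delta < 2)%N ->
       forall int2 : (R[i] -> R[i]) -> R[i], homogeneous int2 ->
       forall PsiL : R[i] -> R[i] -> R[i],
       invariant_function q nu psiL PsiL ->
       fun_herm q nu int2 PsiL
         (fun_act_g nu H (fun zb z =>
            fps_eval (xi1 q nu mu) zb * fps_eval (xi2 q nu mu delta) z))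
       = cpow q (inu nu - 1) * cpow H (inu nu - 1) *
         int2 (fun z : R[i] =>
           qpoch_inf (- cpow q (2 * inu nu + 4) * conjc z * z) (q%:C ^+ 2) /
           qpoch_inf (- q%:C ^+ 2 * conjc z * z) (q%:C ^+ 2) *
           fps_eval (xi1 q nu mu) (cpow q (inu nu + 1) * conjc z) *
           fps_eval (xi2 q nu mu delta)
             (cpow q (inu nu - 1) * H%:C ^- 2 * z))).

Proof.
split; [|split].
- exists (diag2 (inv_coef q nu)); split; first exact/su2_invariantE.
  by move=> f /(su2_invariantE _ q_gt0 q_lt1) ->.
- exact: whittaker_xi.
move=> psiL /(su2_invariantE _ q_gt0 q_lt1) ->.
split=> [int2 int2Z|_ int2 int2Z F invF].
- rewrite /herm mul2_act_g int2Z mulrA.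
  suff -> : conj2 (diag2 (inv_coef q nu)) = diag2 (fps_mul
      (qpoch_inf_fps (- cpow q (2 * inu nu + 4)) (q%:C ^+ 2))
      (fps_inv (qpoch_inf_fps (- q%:C ^+ 2) (q%:C ^+ 2)))) by [].
  apply/funext => m; apply/funext => n; rewrite /conj2 /diag2 eq_sym.
  by case: eqP => [->|_]; rewrite ?conjc0// conjc_inv_coef.
(* Homogeneity moves H^(i nu - 1) under the integral on the right, after which the integrands agree
   pointwise. *)
rewrite /fun_herm -[RHS]mulrA -(int2Z (cpow H _)).
set g := (X in int2 X); set h := (X in _ = _ * int2 X); suff -> : g = h by [].
apply/funext => z; rewrite /g /h /=.
rewrite (invariant_function_conj _ _ invF)// /fun_act_g.
transitivity (cpow H (inu nu - 1) *
  (qpoch_inf (- cpow q (2 * inu nu + 4) * conjc z * z) (q%:C ^+ 2) /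
   qpoch_inf (- q%:C ^+ 2 * conjc z * z) (q%:C ^+ 2) *
   fps_eval (xi1 q nu mu) (cpow q (inu nu + 1) * conjc z) *
   fps_eval (xi2 q nu mu delta) (cpow q (inu nu - 1) * H%:C ^- 2 * z))) => //.
have arrange (n x e1 e2 : R[i]) : n * (x * (e1 * e2)) = x * (n * e1 * e2) by ring.
have -> : H%:C ^- 2 * (cpow q (inu nu - 1) * z) =
    cpow q (inu nu - 1) * H%:C ^- 2 * z.
  by rewrite mulrCA mulrA.
exact: arrange.
Qed.
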